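(* Let $A\in\mathbb{R}^{n\times n}$ be symmetric positive definite and $b\in\mathbb{R}^n$. Generically (i.e. when the residue matrices of the run remain of full rank $p$, so that $n/p$ iterations are counted), multithread execution in exact arithmetic of the cooperative Conjugate Gradient (cCG) algorithm using $p$ agents (one per processor) for the linear system $Ax=b$ of size $n$ requires $$N(p)=\frac{n^3}{p}+6n^2+n\,\frac{(p+1)(2p+1)}{3}$$ scalar multiplications performed synchronously in parallel by each processor.
   Context: The cCG algorithm: choose $X_0\in\mathbb{R}^{n\times p}$, $R_0=AX_0-b\mathbf 1_p^{T}$ ($\mathbf 1_p\in\mathbb{R}^p$ the vector of ones), $D_0=R_0$; while $D_k$ has rank $p$, $\alpha_k=-R_k^{T}D_k(D_k^{T}AD_k)^{-1}$, $X_{k+1}=X_k+D_k\alpha_k^{T}$, $R_{k+1}=AX_{k+1}-b\mathbf 1_p^{T}$ (equivalently $R_{k+1}=R_k+AD_k\alpha_k^{T}$), $\beta_k=-R_{k+1}^{T}AD_k(D_k^{T}AD_k)^{-1}$, $D_{k+1}=R_{k+1}+D_k\beta_k^{T}$. Cost model and multithread implementation. There are $p$ processors; processor $i$ handles the $i$-th column $X_{k,i},R_{k,i},D_{k,i}$ of $X_k,R_k,D_k$ and the $i$-th row $\alpha_{k,i},\beta_{k,i}$ of $\alpha_k,\beta_k$. Only scalar multiplications are counted. In each iteration, processor $i$ performs the following tasks with the indicated numbers of scalar multiplications: 1. computation of $AD_{k,i}$: $n^2$ (results then exchanged between processors); 2. $D_{k,i}^{T}(AD_k)$: $np$ (results then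 exchanged); 3. $R_{k,i}^{T}D_k$: $np$; 4. solution of the $p\times p$ linear system with matrix $D_k^{T}AD_k$ giving $\alpha_{k,i}$, by Gaussian elimination through LU factorization: $\frac{p(p+1)(2p+1)}{6}$; 5. update of $R_{k+1,i}$ from $R_{k,i}$ and $(AD_k)\alpha_{k,i}^{T}$: $np$; 6. update of $X_{k+1,i}$ from $X_{k,i}$ and $D_k\alpha_{k,i}^{T}$: $np$; 7. $R_{k+1,i}^{T}(AD_k)$: $np$; 8. solution of the $p\times p$ linear system with matrix $D_k^{T}AD_k$ giving $\beta_{k,i}$: $\frac{p(p+1)(2p+1)}{6}$; 9. update $D_{k+1,i}=R_{k+1,i}+D_k\beta_{k,i}^{T}$: $np$. Under the generic assumption that the residue matrices keep full rank $p$, the worst-case cost of the run is, by convention, that of $n/p$ iterations (the at most $p-1$ supplementary ordinary CG steps needed when $p$ does not divide $n$ are disregarded). *)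

(* Defs.v *)
From HB Require Import structures.
From mathcomp Require Import all_boot all_order all_algebra.
From mathcomp Require Import reals.
Set Implicit Arguments.
Unset Strict Implicit.
Unset Printing Implicit Defensive.
Import Order.TTheory GRing.Theory Num.Theory.
Local Open Scope ring_scope.

Definition symposdefmx (R : realType) (n : nat) (A : 'M[R]_n) : Prop :=
  A^T = A /\ forall x : 'cV[R]_n, x != 0 -> 0 < (x^T *m A *m x) 0 0.

Record state (R : realType) (n p : nat) : Type := State {
  iterate : 'M[R]_(n, p);
  residue : 'M[R]_(n, p);
  direction : 'M[R]_(n, p) }.

Section CooperativeCG.
Variables (R : realType) (n p : nat) (A : 'M[R]_n) (b : 'cV[R]_n).

Definition ccg_residue (X : 'M[R]_(n, p)) : 'M[R]_(n, p) :=
  A *m X - b *m (const_mx 1 : 'rV[R]_p).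

Definition ccg_init (X0 : 'M[R]_(n, p)) : state R n p :=
  State X0 (ccg_residue X0) (ccg_residue X0).

Definition ccg_step (s : state R n p) : state R n p :=
  let: State X Rk D := s in
  let DAD := D^T *m A *m D in
  let alpha := - (Rk^T *m D) *m invmx DAD in
  let X' := X + D *m alpha^T in
  let R' := ccg_residue X' in
  let beta := - (R'^T *m A *m D) *m invmx DAD in
  State X' R' (R' + D *m beta^T).

(* The iterates are total in k; they are those of the algorithm as long as the
   loop guard (the direction matrix has rank p) has held so far. *)
Definition ccg (X0 : 'M[R]_(n, p)) (k : nat) : state R n p :=
  iter k ccg_step (ccg_init X0).

(* The loop "while the direction matrix has rank p" runs exactly K times. *)
Definition ccg_loop_count (X0 : 'M[R]_(n, p)) (K : nat) : Prop :=
  (forall k, (k < K)%N -> \rank (direction (ccg X0 k)) = p) /\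
  \rank (direction (ccg X0 K)) <> p.

End CooperativeCG.

(* A result together with the number of scalar multiplications spent on it. *)
Record counted (T : Type) : Type := Counted { mults : nat; value : T }.

Section MultithreadCG.
Variable R : realType.

Definition cmul (x y : R) : counted R := Counted 1 (x * y).

(* Schoolbook product; additions are free. *)
Definition cmulmx_entry m n q (A : 'M[R]_(m, n)) (B : 'M[R]_(n, q))
    (i : 'I_m) (j : 'I_q) : counted R :=
  Counted (\sum_(k < n) mults (cmul (A i k) (B k j)))%N
          (\sum_(k < n) value (cmul (A i k) (B k j))).

Definition cmulmx m n q (A : 'M[R]_(m, n)) (B : 'M[R]_(n, q)) :
    counted 'M[R]_(m, q) :=
  Counted (\sum_(i < m) \sum_(j < q) mults (cmulmx_entry A B i j))%N
          (\matrix_(i, j) value (cmulmx_entry A B i j)).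

(* Solves x *m M = v. Gaussian elimination is not expanded into scalar
   operations: it is charged p(p+1)(2p+1)/6 multiplications (the division is
   exact), which is part of the cost model. *)
Definition csolve p (M : 'M[R]_p) (v : 'rV[R]_p) : counted 'rV[R]_p :=
  Counted ((p * p.+1 * (2 * p).+1) %/ 6)%N (v *m invmx M).

(* Exchange of results: every processor gets the columns (rows) computed by
   all of them. *)
Definition gather_cols m p (f : 'I_p -> counted 'cV[R]_m) : 'M[R]_(m, p) :=
  \matrix_(r, i) value (f i) r 0.

Definition gather_rows m p (f : 'I_p -> counted 'rV[R]_m) : 'M[R]_(p, m) :=
  \matrix_(i, r) value (f i) 0 r.

Variables (n p : nat) (A : 'M[R]_n) (b : 'cV[R]_n).

(* The machine state also holds, for each processor, the number of scalar
   multiplications it has performed so far. *)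
Definition mt_state : Type := (state R n p * ('I_p -> nat))%type.

(* t1 i, ..., t9 i are the successive tasks of processor i; all processors
   execute the same task at the same time. *)
Definition mt_step (S : mt_state) : mt_state :=
  let: (State X Rk D, count) := S in
  let t1 i := cmulmx A (col i D) in
  let AD := gather_cols t1 in
  let t2 i := cmulmx (col i D)^T AD in
  let DAD := gather_rows t2 in
  let t3 i := cmulmx (col i Rk)^T D in
  let t4 i := csolve DAD (- value (t3 i)) in
  let t5 i := cmulmx AD (value (t4 i))^T in
  let R' i := col i Rk + value (t5 i) in
  let t6 i := cmulmx D (value (t4 i))^T in
  let X' i := col i X + value (t6 i) in
  let t7 i := cmulmx (R' i)^T AD in
  let t8 i := csolve DAD (- value (t7 i)) in
  let t9 i := cmulmx D (value (t8 i))^T in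
  let D' i := R' i + value (t9 i) in
  (State (\matrix_(r, i) X' i r 0) (\matrix_(r, i) R' i r 0)
         (\matrix_(r, i) D' i r 0),
   fun i => (count i +
     (mults (t1 i) + mults (t2 i) + mults (t3 i) + mults (t4 i) + mults (t5 i)
      + mults (t6 i) + mults (t7 i) + mults (t8 i) + mults (t9 i)))%N).

(* Only what happens inside iterations is counted, not the initialisation. *)
Definition mt_run (X0 : 'M[R]_(n, p)) (k : nat) : mt_state :=
  iter k mt_step (ccg_init A b X0, fun=> 0%N).

Definition mt_mults (X0 : 'M[R]_(n, p)) (k : nat) (i : 'I_p) : nat :=
  (mt_run X0 k).2 i.

(* Multiplications performed by processor i in n / p iterations, where n / p is
   the rational quotient. If p does not divide n, the fractional iteration left
   after n %/ p full ones is charged the fraction (n %% p) / p of an iteration;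
   the ordinary CG steps that would finish the run are disregarded. *)
Definition worst_case_mults (X0 : 'M[R]_(n, p)) (i : 'I_p) : rat :=
  let q := (n %/ p)%N in
  (mt_mults X0 q i)%:R
    + (n %% p)%:R / p%:R * ((mt_mults X0 q.+1 i)%:R - (mt_mults X0 q i)%:R).

Lemma value_cmulmx m k q (B : 'M[R]_(m, k)) (C : 'M[R]_(k, q)) :
  value (cmulmx B C) = B *m C.
Proof. by apply/matrixP => i j; rewrite !mxE. Qed.

(* The multithread execution computes the iterates of the algorithm. *)
Lemma mt_run_ccg (X0 : 'M[R]_(n, p)) (k : nat) :
  (mt_run X0 k).1 = ccg A b X0 k.
Proof.
have inv j : residue (ccg A b X0 j) = ccg_residue A b (iterate (ccg A b X0 j)).
  by case: j => [|j] //; rewrite /ccg iterS; case: (iter _ _ _).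
elim: k => // k; rewrite /mt_run /ccg !iterS -/(ccg A b X0 k) -/(mt_run X0 k).
move: (inv k); case: (mt_run X0 k) => s c + sE.
move: sE; rewrite [fst _]/fst => -> {s}.
case: (ccg A b X0 k) => X Rk D; rewrite [residue _]/= [iterate _]/= => defR.
rewrite /mt_step /ccg_step [fst _]/fst; cbv zeta.
set W := gather_cols _; have defW : W = A *m D.
  apply/matrixP => r i; rewrite mxE value_cmulmx !mxE.
  by apply: eq_bigr => j _; rewrite !mxE.
set G := gather_rows _; have defG : G = D^T *m A *m D.
  apply/matrixP => i r; rewrite mxE value_cmulmx -mulmxA -defW !mxE.
  by apply: eq_bigr => j _; rewrite !mxE.
rewrite {}defG {}defW; set M := invmx _.
set al := - (Rk^T *m D) *m M.
have alE i : - value (cmulmx (col i Rk)^T D) *m M = row i al.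
  by rewrite value_cmulmx /al row_mul linearN /= row_mul tr_col.
have XE : \matrix_(r, i) (col i X + value (cmulmx D
    (- value (cmulmx (col i Rk)^T D) *m M)^T)) r 0 = X + D *m al^T.
  apply/matrixP => r i; rewrite mxE alE value_cmulmx !mxE; congr (_ + _).
  by apply: eq_bigr => j _; rewrite !mxE.
have colR i : col i Rk + value (cmulmx (A *m D)
    (- value (cmulmx (col i Rk)^T D) *m M)^T)
    = col i (ccg_residue A b (X + D *m al^T)).
  rewrite alE value_cmulmx tr_row !colE mulmxA -mulmxDl.
  by rewrite defR /ccg_residue mulmxDr mulmxA addrAC.
rewrite XE; set R' := ccg_residue _ _ _ in colR *.
congr State; first by apply/matrixP => r i; rewrite mxE colR mxE.
set be := - _ *m M.
apply/matrixP => r i; rewrite [LHS]mxE !colR !value_cmulmx /=.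
have -> : - ((col i R')^T *m (A *m D)) *m M = row i be.
  by rewrite /be row_mul linearN /= -mulmxA row_mul tr_col.
by rewrite tr_row !colE mulmxA -mulmxDl -colE mxE.
Qed.

End MultithreadCG.

(* Main.v *)
Require Import Defs.
From HB Require Import structures.
From mathcomp Require Import all_boot all_order all_algebra.
From mathcomp Require Import reals.
From mathcomp Require Import ring.
Set Implicit Arguments.
Unset Strict Implicit.
Unset Printing Implicit Defensive.
Import Order.TTheory GRing.Theory Num.Theory.
Local Open Scope ring_scope.

(** The loop count rests on the two orthogonality relations of block conjugate
    gradients: for j < i, the residue [R_i] is orthogonal to the direction
    [D_j], and [D_i] is [A]-conjugate to [D_j].  They are proved together by
    induction on i in [residue_orthogonal_direction_conjugate].  The choice of
    alpha and beta settles the case of two consecutive indices; for earlier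
    directions, [A D_j alpha_j^T = R_{j+1} - R_j] turns conjugacy into
    orthogonality of residues, provided that [alpha_j] is invertible.  It is,
    because [R_j^T D_j] is the Gram matrix of [R_j], and this is where the
    full rank of the residues enters.

    As long as the residue has rank p, so has the direction, again because
    [R_k^T D_k = R_k^T R_k] is invertible; hence the loop does not stop before
    n %/ p iterations.  It stops then, because the column spaces of conjugate
    matrices are independent, so that their ranks add up to at most n
    ([conjugate_sum_rank]): after n %/ p directions of rank p, fewer than p
    dimensions are left for the next one.

    The number of multiplications in one iteration depends on neither the
    data nor the processor, so the count is n / p times that constant.  For
    the remainder, n / p = n %/ p + (n %% p) / p is the weight with which
    iterations are counted. *)

(** * Positive definite forms *)

Section PositiveDefinite.
Variable R : realType.

Lemma symposdefmx1 n : symposdefmx (1%:M : 'M[R]_n).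
Proof.
split=> [|x x0]; first exact: trmx1.
have sq_ge0 i : true -> 0 <= x^T 0 i * x i 0 by rewrite mxE -expr2 sqr_ge0.
rewrite mulmx1 mxE lt_def sumr_ge0 // andbT; apply: contra x0.
rewrite psumr_eq0 // => /allP x0; apply/eqP/colP => i; apply/eqP.
by have := x0 i (mem_index_enum _); rewrite !mxE mulf_eq0 orbb.
Qed.

Lemma symposdef_form_eq0 n (A : 'M[R]_n) (w : 'rV[R]_n) :
  symposdefmx A -> w *m A *m w^T = 0 -> w = 0.
Proof.
move=> [_ A_gt0] wAw; apply: trmx_inj; rewrite trmx0; apply/eqP.
apply: contraT => /A_gt0.
by rewrite trmxK wAw mxE ltxx.
Qed.

Lemma unitmx_gram n p (A : 'M[R]_n) (D : 'M[R]_(n, p)) :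
  symposdefmx A -> \rank D = p -> D^T *m A *m D \in unitmx.
Proof.
move=> A_spd rkD; rewrite -row_free_unit; apply: inj_row_free => v vG.
have freeDt : row_free D^T by rewrite /row_free mxrank_tr rkD.
apply: (row_free_inj freeDt); rewrite mul0mx.
apply: (symposdef_form_eq0 A_spd).
by rewrite trmx_mul trmxK mulmxA -2!(mulmxA v) vG mul0mx.
Qed.

(** Conjugacy makes the column spaces independent: a common vector [w] of two
    conjugate spaces satisfies [w A w^T = 0]. *)
Lemma conjugate_sum_rank n p (A : 'M[R]_n) (D : nat -> 'M[R]_(n, p)) m :
  symposdefmx A ->
  (forall i j, (j < i < m)%N -> (D i)^T *m A *m D j = 0) ->
  (\sum_(i < m) \rank (D i) <= n)%N.
Proof.
move=> A_spd conj.
suff <- : \rank (\sum_(i < m) <<(D i)^T>>)%MS = (\sum_(i < m) \rank (D i))%N.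
  exact: rank_leq_col.
elim: m => [|m IH] in conj *; first by rewrite !big_ord0 mxrank0.
rewrite !big_ord_recr /= mxrank_disjoint_sum; last first.
  apply/eqP; rewrite -submx0; apply/row_subP => r.
  have := row_sub r (\sum_(i < m) <<(D i)^T>> :&: <<(D m)^T>>)%MS.
  move: (row r _) => w; rewrite sub_capmx => /andP[wS wD].
  rewrite (_ : w = 0) ?sub0mx //; apply: (symposdef_form_eq0 A_spd).
  move: wD; rewrite genmxE => /submxP[u uE].
  move: wS => /sub_sumsmxP[v vE].
  rewrite {1}uE vE linear_sum mulmx_sumr big1 //= => j _.
  have /submxP[x ->] : (v j *m <<(D j)^T>> <= (D j)^T)%MS.
    by rewrite (submx_trans (submxMl _ _)) ?genmxE.
  rewrite trmx_mul trmxK mulmxA -2!(mulmxA u) conj ?ltn_ord //=.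
  by rewrite mulmx0 mul0mx.
rewrite IH; last by move=> i j /andP[ji im]; apply: conj; rewrite ji ltnW.
by rewrite genmxE mxrank_tr.
Qed.

End PositiveDefinite.

(** * Orthogonality and conjugacy along a run *)

Section Run.
Variables (R : realType) (n p : nat) (A : 'M[R]_n) (b : 'cV[R]_n).
Variable X0 : 'M[R]_(n, p).
Hypothesis A_spd : symposdefmx A.

Let Rs k := residue (ccg A b X0 k).
Let D k := direction (ccg A b X0 k).
Let G k := (D k)^T *m A *m D k.
Let alpha k := - ((Rs k)^T *m D k) *m invmx (G k).
Let beta k := - ((Rs k.+1)^T *m A *m D k) *m invmx (G k).

Lemma residue_ccg k : Rs k = ccg_residue A b (iterate (ccg A b X0 k)).
Proof. by case: k => [|k] //; rewrite /Rs /ccg iterS; case: (iter _ _ _). Qed.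

Lemma residueS k : Rs k.+1 = Rs k + A *m D k *m (alpha k)^T.
Proof.
have := residue_ccg k; rewrite /alpha /G /Rs /D /ccg iterS.
case: (iter _ _ _) => X Rk Dk /= defR.
by rewrite /ccg_residue mulmxDr mulmxA addrAC -/(ccg_residue A b X) -defR.
Qed.

Lemma directionS k : D k.+1 = Rs k.+1 + D k *m (beta k)^T.
Proof. by rewrite /beta /G /Rs /D /ccg iterS; case: (iter _ _ _). Qed.

(** [D_k] and [R_k] differ by a combination of the columns of [D_{k-1}],
    which [B^T] annihilates. *)
Lemma orthogonal_mul_direction k (B : 'M[R]_(n, p)) :
  (forall j, (j < k)%N -> B^T *m D j = 0) ->
  B^T *m D k = B^T *m Rs k.
Proof.
case: k => [|k] orth //.
by rewrite directionS mulmxDr mulmxA orth // mul0mx addr0.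
Qed.

(** [R_k^T D_k] is the Gram matrix of [R_k]; this is how full rank of the
    residues acts on the directions and on [alpha_k]. *)
Lemma residue_direction_unit k :
  (forall j, (j < k)%N -> (Rs k)^T *m D j = 0) -> \rank (Rs k) = p ->
  (Rs k)^T *m D k \in unitmx.
Proof.
move=> orth rkR; rewrite orthogonal_mul_direction //.
by have := unitmx_gram (symposdefmx1 _ _) rkR; rewrite mulmx1.
Qed.

Lemma rank_direction k :
  (forall j, (j < k)%N -> (Rs k)^T *m D j = 0) -> \rank (Rs k) = p ->
  \rank (D k) = p.
Proof.
move=> orth rkR; apply/eqP; rewrite eqn_leq rank_leq_col /=.
by rewrite -{1}(mxrank_unit (residue_direction_unit orth rkR)) mxrankM_maxr.
Qed.

(** The relations for i + 1 follow from those for all indices up to i.  Full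
    rank of [R_k] for k <= i makes the matrices [D_k^T A D_k] and [alpha_k]
    invertible, without which neither the choice of the coefficients nor the
    elimination of [A D_j] would work. *)
Lemma residue_orthogonal_direction_conjugate m :
  (forall k, (k < m)%N -> \rank (Rs k) = p) ->
  forall i, (i <= m)%N -> forall j, (j < i)%N ->
    (Rs i)^T *m D j = 0 /\ (D i)^T *m A *m D j = 0.
Proof.
move=> rkR i; elim/ltn_ind: i => -[|i] IH // im.
have orth k : (k <= i)%N -> forall j, (j < k)%N -> (Rs k)^T *m D j = 0.
  by move=> ki j jk; case: (IH k ki (leq_trans ki (ltnW im)) j jk).
have conj j : (j < i)%N -> (D i)^T *m A *m D j = 0.
  by move=> ji; case: (IH i (leqnn _) (ltnW im) j ji).
have unitRD k : (k <= i)%N -> (Rs k)^T *m D k \in unitmx.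
  move=> ki; apply: residue_direction_unit; first exact: orth.
  exact/rkR/(leq_ltn_trans ki).
have unitG k : (k <= i)%N -> G k \in unitmx.
  move=> ki; apply: unitmx_gram => //.
  by apply: rank_direction; [exact: orth | exact/rkR/(leq_ltn_trans ki)].
have orthS j : (j < i.+1)%N -> (Rs i.+1)^T *m D j = 0.
  rewrite ltnS leq_eqVlt residueS linearD /= trmx_mul trmxK trmx_mul A_spd.1.
  rewrite mulmxDl -(mulmxA (alpha i)) => /predU1P[->|ji].
    by rewrite -/(G i) /alpha mulmxKV ?unitG // subrr.
  by rewrite (orth i) // conj // mulmx0 addr0.
move=> j ji; split; first exact: orthS.
rewrite directionS linearD /= trmx_mul trmxK !mulmxDl -2!(mulmxA (beta i)).
move: (ji); rewrite ltnS leq_eqVlt => /predU1P[->|ji'].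
  by rewrite -/(G i) /beta mulmxKV ?unitG // subrr.
rewrite conj // mulmx0 addr0.
have unit_alpha : (alpha j)^T \in unitmx.
  rewrite unitmx_tr unitmx_mul unitmx_inv unitG ?(ltnW ji') // andbT.
  by rewrite -row_free_unit /row_free mxrank_opp mxrank_unit ?unitRD // ltnW.
apply: (can_inj (mulmxK unit_alpha)); rewrite mul0mx -2!(mulmxA (Rs i.+1)^T).
have -> : A *m D j *m (alpha j)^T = Rs j.+1 - Rs j.
  by rewrite residueS addrC addKr.
(* On the left of [D_j], a matrix that annihilates the earlier directions may
   trade [R_j] for [D_j], and [R_{i+1}] annihilates all of them. *)
rewrite mulmxBr -!orthogonal_mul_direction ?orthS ?subrr // => k kj;
  by apply: orthS; apply: ltn_trans kj _.
Qed.

End Run.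

(** * Cost of the iterations *)

(** The quotient is the sum of the squares of 1, ..., q. *)
Lemma dvdn6_sum_squares q : (6 %| q * q.+1 * (2 * q).+1)%N.
Proof.
suff -> : (q * q.+1 * (2 * q).+1 = 6 * \sum_(i < q.+1) i ^ 2)%N.
  exact: dvdn_mulr.
elim: q => [|q IH]; first by rewrite big_ord1.
by rewrite big_ord_recr mulnDr -IH /=; ring.
Qed.

Section Cost.
Variables (R : realType) (n p : nat) (A : 'M[R]_n) (b : 'cV[R]_n).
Variable X0 : 'M[R]_(n, p).

Lemma mults_cmulmx m k q (B : 'M[R]_(m, k)) (C : 'M[R]_(k, q)) :
  mults (cmulmx B C) = (m * q * k)%N.
Proof.
rewrite /= (eq_bigr (fun=> q * k)%N) => [|i _].
  by rewrite sum_nat_const card_ord mulnA.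
by rewrite (eq_bigr (fun=> k)) => [|j _]; rewrite sum_nat_const card_ord ?muln1.
Qed.

(** The nine tasks: [A D_{k,i}], six products of size n by p, and two linear
    systems. *)
Definition step_mults : nat :=
  n ^ 2 + 6 * (n * p) + 2 * ((p * p.+1 * (2 * p).+1) %/ 6).

Lemma mt_mults_linear k i : mt_mults A b X0 k i = (k * step_mults)%N.
Proof.
elim: k => [|k IH] //; rewrite mulSn -IH /mt_mults /mt_run iterS.
case: (iter _ _ _) => -[X Rk D] count; rewrite /mt_step /snd; cbv beta zeta.
rewrite !mults_cmulmx /csolve /mults /step_mults.
ring.
Qed.

Lemma step_mults_rat : (step_mults%:R : rat) =
  n%:R ^+ 2 + 6%:R * (n%:R * p%:R)
    + p%:R * (p%:R + 1) * (2%:R * p%:R + 1) / 3%:R.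
Proof.
have e : ((p * p.+1 * (2 * p).+1) %/ 6)%:R * 6%:R
    = p%:R * (p%:R + 1) * (2%:R * p%:R + 1) :> rat.
  by rewrite -natrM divnK ?dvdn6_sum_squares // !natrM -!natr1 natrM.
by rewrite -e /step_mults !natrD !natrM; field.
Qed.

End Cost.

Theorem theorem5 (R : realType) (n p : nat) (A : 'M[R]_n) (b : 'cV[R]_n)
    (X0 : 'M[R]_(n, p))
    (p_gt0 : (0 < p)%N) (p_le_n : (p <= n)%N)
    (A_spd : symposdefmx A)
    (generic : forall k, (k < n %/ p)%N -> \rank (residue (ccg A b X0 k)) = p) :
  ccg_loop_count A b X0 (n %/ p)%N /\
  forall i : 'I_p,
    worst_case_mults A b X0 i =
      n%:R ^+ 3 / p%:R + 6%:R * n%:R ^+ 2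
        + n%:R * ((p%:R + 1) * (2%:R * p%:R + 1) / 3%:R).
Proof.
have orth := residue_orthogonal_direction_conjugate A_spd generic.
have rkD k : (k < n %/ p)%N -> \rank (direction (ccg A b X0 k)) = p.
  move=> kq; apply: rank_direction; last exact: generic.
  by move=> j jk; case: (orth k (ltnW kq) j jk).
split.
  split=> // rkDq.
  have conj i j : (j < i < (n %/ p).+1)%N ->
      (direction (ccg A b X0 i))^T *m A *m direction (ccg A b X0 j) = 0.
    by move=> /andP[ji iq]; case: (orth i iq j ji).
  have := conjugate_sum_rank A_spd conj.
  rewrite big_ord_recr /= rkDq (eq_bigr (fun=> p)) => [|k _]; last exact: rkD.
  by rewrite sum_nat_const card_ord -mulSnr leqNgt ltn_ceil.
move=> i; rewrite /worst_case_mults !mt_mults_linear.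
have p0 : p%:R != 0 :> rat by rewrite pnatr_eq0 -lt0n.
have nE : n%:R = (n %/ p)%:R * p%:R + (n %% p)%:R :> rat.
  by rewrite -natrM -natrD -divn_eq.
rewrite mulSn natrD addrK natrM.
have -> : (n %/ p)%:R * (step_mults n p)%:R
      + (n %% p)%:R / p%:R * (step_mults n p)%:R
    = n%:R / p%:R * (step_mults n p)%:R :> rat by rewrite nE; field.
by rewrite step_mults_rat; field.
Qed.
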